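(* Let $X$ be a Polish space, and $A\subseteq X^\omega$ an analytic (i.e. $\mathbf{\Sigma}^1_1$) set. Then exactly one of the following holds: (a) $[X,A]\preceq_{B}[\omega,\neg\Delta^\omega(\omega)]$. (b) $[\omega^{\omega},\mathbb{A}_{\omega}]\preceq_{Bm}[X,A]$.
   Context: Here $\omega=\{0,1,2,\dots\}$ carries the discrete topology and $\omega^\omega$ the product topology. $\omega^{<\omega}$ is the set of finite sequences of elements of $\omega$, $|s|$ is the length of $s$, juxtaposition denotes concatenation, and $0^k$ is the sequence of $k$ zeros. For a set $Y$, $\Delta^\omega(Y):=\{(y_i)_{i\in\omega}\in Y^\omega\mid \forall i\in\omega\ \ y_i=y_0\}$, and $\neg\Delta^\omega(\omega):=\omega^\omega\setminus\Delta^\omega(\omega)$. For a map $u:X\to Y$, $u^\omega:X^\omega\to Y^\omega$ is defined by $u^\omega[(x_i)_{i\in\omega}]:=(u(x_i))_{i\in\omega}$. For Polish spaces $X,Y$ and $A\subseteq X^\omega$, $B\subseteq Y^\omega$, we write $[X,A]\preceq_B[Y,B]$ (resp. $[X,A]\preceq_{Bm}[Y,B]$) if there is a Borel (resp. Baire-measurable) map $u:X\to Y$ with $A\subseteq (u^\omega)^{-1}(B)$. A map is Baire-measurable if the preimage of every open set has the Baire property. Let $(p_n)_{n\in\omega}$ be the sequence of prime numbers, and define the injection $I:\omega^{<\omega}\to\omega$ by $I(\emptyset):=1$ and $I(s):=p_0^{s(0)+1}\cdots p_{|s|-1}^{s(|s|-1)+1}$ if $s\neq\emptyset$. Let $\varphi:I[\omega^{<\omega}]\to\omega$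 be the increasing bijection, and $\psi_\omega:=(\varphi\circ I)^{-1}:\omega\to\omega^{<\omega}$, a bijection with $|\psi_\omega(n)|\le n$. Set $s^\omega_n:=\psi_\omega(n)0^{n-|\psi_\omega(n)|}$, a sequence of length $n$. Finally $$\mathbb{A}_\omega:=\{(s^\omega_n i\gamma)_{i\in\omega}\mid n\in\omega,\ \gamma\in\omega^\omega\}\subseteq(\omega^\omega)^\omega.$$ *)

(* Defs.v *)
From mathcomp Require Import all_boot all_order all_algebra.
From mathcomp Require Import all_classical all_reals topology measure.

Set Implicit Arguments.
Unset Strict Implicit.
Unset Printing Implicit Defensive.

Import Order.TTheory GRing.Theory Num.Theory.

Local Open Scope classical_set_scope.

Definition is_metric (R : realType) (T : Type) (d : T -> T -> R) : Prop :=
  [/\ forall x y, d x y = 0%R <-> x = y,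
      forall x y, d x y = d y x &
      forall x y z, (d x z <= d x y + d y z)%R].

Definition compatible_metric (R : realType) (T : topologicalType)
    (d : T -> T -> R) : Prop :=
  forall x : T, nbhs x = nbhs_ball_ (fun y e => [set z | (d y z < e)%R]) x.

Definition complete_metric (R : realType) (T : topologicalType)
    (d : T -> T -> R) : Prop :=
  forall u : nat -> T,
    (forall e : R, (0 < e)%R ->
      exists N : nat, forall m n, N <= m -> N <= n -> (d (u m) (u n) < e)%R) ->
    exists l : T, u @ \oo --> l.

Definition separable (T : topologicalType) : Prop :=
  exists2 D : set T, countable D & dense D.

(* The empty space is Polish: library topological types need not be pointed. *)
Definition polish (R : realType) (T : topologicalType) : Prop :=
  separable T /\
  exists d : T -> T -> R,
    [/\ is_metric d, compatible_metric d & complete_metric d].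

(* Analytic subsets are the continuous images of Polish spaces; a continuous
   image of the empty space is empty. *)
Definition analytic (R : realType) (T : topologicalType) (A : set T) : Prop :=
  exists (Y : topologicalType) (f : Y -> T),
    [/\ polish R Y, continuous f & A = range f].

(* The library's measurable types are pointed, so the Borel sigma-algebra is
   used here as a set of sets rather than as a measurable structure. *)
Definition borel (T : topologicalType) : set (set T) := <<s @open T >>.

Definition borel_map (X Y : topologicalType) (u : X -> Y) : Prop :=
  forall B : set Y, borel B -> borel (u @^-1` B).

Definition nowhere_dense (T : topologicalType) (A : set T) : Prop :=
  interior (closure A) = set0.

Definition meager (T : topologicalType) (A : set T) : Prop :=
  exists2 F : nat -> set T,
    forall n, nowhere_dense (F n) & A = \bigcup_n F n.

Definition baire_property (T : topologicalType) (A : set T) : Prop :=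
  exists2 U : set T, open U & meager (A `+` U).

Definition baire_measurable_map (X Y : topologicalType) (u : X -> Y) : Prop :=
  forall V : set Y, open V -> baire_property (u @^-1` V).

(* [nat] carries the discrete topology, and [{ptws nat -> T}] is [nat -> T]
   with the product topology. *)
Notation pow_omega T := {ptws nat -> T}.
Notation baire_space := (pow_omega nat).

Definition map_omega (X Y : Type) (u : X -> Y) (x : nat -> X) : nat -> Y :=
  fun i => u (x i).

Definition borel_reducible (X Y : topologicalType)
    (A : set (pow_omega X)) (B : set (pow_omega Y)) : Prop :=
  exists2 u : X -> Y, borel_map u & A `<=` map_omega u @^-1` B.

Definition baire_reducible (X Y : topologicalType)
    (A : set (pow_omega X)) (B : set (pow_omega Y)) : Prop :=
  exists2 u : X -> Y, baire_measurable_map u & A `<=` map_omega u @^-1` B.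

Definition diagonal_omega (Y : Type) : set (nat -> Y) :=
  [set y | forall i, y i = y 0].

Definition not_diagonal : set (pow_omega nat) := ~` @diagonal_omega nat.

Lemma next_prime_ex (m : nat) : exists p, prime p && (m < p).
Proof. by have [p mp pp] := prime_above m; exists p; rewrite pp. Qed.

Fixpoint nth_prime (n : nat) : nat :=
  if n is m.+1 then ex_minn (next_prime_ex (nth_prime m)) else 2.

(* The empty product accounts for the value 1 at the empty sequence. *)
Definition seq_code (s : seq nat) : nat :=
  \prod_(i < size s) nth_prime i ^ (nth 0 s i).+1.

(* [code_rank] restricted to the range of [seq_code] is the increasing
   bijection onto [nat]: see [code_rank_bij] and [code_rank_incr]. *)
Definition code_rank (m : nat) : nat :=
  count (fun k => k \in range seq_code) (iota 0 m).

(* The inverse of [code_rank \o seq_code]: see [psiK] and [rank_codeK]. *)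
Definition psi (n : nat) : seq nat :=
  xget [::] [set s | code_rank (seq_code s) = n].

(* The subtraction does not truncate: see [size_psi]. *)
Definition s_omega (n : nat) : seq nat :=
  psi n ++ nseq (n - size (psi n)) 0.

Definition concat (s : seq nat) (g : nat -> nat) : nat -> nat :=
  fun k => if k < size s then nth 0 s k else g (k - size s).

Definition A_omega : set (pow_omega baire_space) :=
  [set x | exists (n : nat) (g : nat -> nat),
             x = fun i => concat (rcons (s_omega n) i) g].

Lemma nth_prime_prime n : prime (nth_prime n).
Proof. by case: n => //= n; case: ex_minnP => p /andP[]. Qed.

Lemma nth_prime_ltS n : nth_prime n < nth_prime n.+1.
Proof. by rewrite /=; case: ex_minnP => p /andP[]. Qed.

Lemma nth_prime_lt m n : m < n -> nth_prime m < nth_prime n.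
Proof.
elim: n => // n IHn; rewrite ltnS leq_eqVlt => /predU1P[->|/IHn h].
  exact: nth_prime_ltS.
exact: ltn_trans h (nth_prime_ltS n).
Qed.

Lemma nth_prime_inj : injective nth_prime.
Proof.
by move=> m n e; case: (ltngtP m n) => // /nth_prime_lt; rewrite e ltnn.
Qed.

Lemma nth_prime_surj p : prime p -> exists n, nth_prime n = p.
Proof.
move=> pp; have ge n : n < nth_prime n.
  by elim: n => // n IHn; exact: leq_ltn_trans IHn (nth_prime_ltS n).
have : exists n, p <= nth_prime n by exists p; exact: ltnW.
move=> /ex_minnP[[|n] pn nmin].
  by exists 0; apply/eqP; rewrite eqn_leq pn prime_gt1.
exists n.+1; apply/eqP; rewrite eqn_leq pn andbT /=.
case: ex_minnP => q _; apply; rewrite pp ltnNge; apply/negP => /nmin.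
by rewrite ltnn.
Qed.

Lemma logn_seq_code s i :
  logn (nth_prime i) (seq_code s) = if i < size s then (nth 0 s i).+1 else 0.
Proof.
rewrite /seq_code; elim: (size s) => [|k IHk]; first by rewrite big_ord0 logn1.
have gt0 j : 0 < nth_prime j ^ (nth 0 s j).+1.
  by rewrite expn_gt0 prime_gt0 ?nth_prime_prime.
rewrite big_ord_recr /= lognM ?prodn_gt0 //.
rewrite IHk lognX logn_prime ?nth_prime_prime // (inj_eq nth_prime_inj) ltnS.
by case: (ltngtP i k) => h; rewrite ?muln0 ?muln1 ?h ?addn0 ?add0n.
Qed.

Lemma seq_code_inj : injective seq_code.
Proof.
move=> s t st.
have e i : (if i < size s then (nth 0 s i).+1 else 0)
         = (if i < size t then (nth 0 t i).+1 else 0).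
  by rewrite -!logn_seq_code st.
have szst : size s = size t.
  case: (ltngtP (size s) (size t)) => // h.
    by have := e (size s); rewrite h ltnn.
  by have := e (size t); rewrite h ltnn.
apply: (@eq_from_nth _ 0) => // i h.
by have := e i; rewrite -szst h => -[].
Qed.

Lemma code_rankS m : code_rank m.+1 = code_rank m + (m \in range seq_code).
Proof. by rewrite /code_rank -addn1 iotaD count_cat /= add0n addn0. Qed.

Lemma code_rank_le m n : m <= n -> code_rank m <= code_rank n.
Proof. by move=> /subnKC<-; rewrite /code_rank iotaD count_cat leq_addr. Qed.

Lemma code_rank_incr m n :
  range seq_code m -> m < n -> code_rank m < code_rank n.
Proof.
move=> /mem_set Cm /code_rank_le; apply: leq_trans.
by rewrite code_rankS Cm addn1.
Qed.

Lemma code_rank_bij : set_bij (range seq_code) [set: nat] code_rank.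
Proof.
split=> //.
- move=> m n /set_mem Cm /set_mem Cn e.
  case: (ltngtP m n) => // h.
    by have := code_rank_incr Cm h; rewrite e ltnn.
  by have := code_rank_incr Cn h; rewrite e ltnn.
- move=> n _.
  have : exists m, n < code_rank m.
    elim: n => [|n [m IHm]].
      exists 2; rewrite code_rankS; suff -> : 1 \in range seq_code by rewrite addn1.
      by apply/mem_set; exists [::]; rewrite // /seq_code big_ord0.
    have Ck : range seq_code (seq_code [:: m]) by exists [:: m].
    exists (seq_code [:: m]).+1; apply: leq_ltn_trans (code_rank_incr Ck _) => //.
    apply: leq_trans IHm (code_rank_le _).
    by rewrite /seq_code big_ord_recl big_ord0 muln1 ltnW // ltnW // ltn_expl.
  move=> /ex_minnP[[|m]//]; rewrite code_rankS => nm mmin.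
  have mn : code_rank m <= n.
    by rewrite leqNgt; apply/negP => /mmin; rewrite ltnn.
  case: (boolP (m \in range seq_code)) nm => [Cm|_]; last first.
    by rewrite addn0 ltnNge mn.
  rewrite addn1 ltnS => nm; exists m; first exact: set_mem.
  by apply/eqP; rewrite eqn_leq nm mn.
Qed.

Lemma psiK n : code_rank (seq_code (psi n)) = n.
Proof.
rewrite /psi; case: xgetP => [s _ //|nos].
have [_ _ /(_ n I)[_ [s _ <-] sn]] := code_rank_bij.
by case: (nos s).
Qed.

Lemma rank_codeK s : psi (code_rank (seq_code s)) = s.
Proof.
have [_ inj _] := code_rank_bij.
apply/seq_code_inj/inj; last exact: psiK.
all: by apply/mem_set; eexists.
Qed.

Lemma size_psi n : size (psi n) <= n.
Proof.
set s := psi n; rewrite -[leqRHS](psiK n) -/s.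
have code0S k : seq_code (nseq k 0) < seq_code (nseq k.+1 0).
  rewrite /seq_code !size_nseq big_ord_recr /=.
  have -> : \prod_(i < k) nth_prime i ^ (nth 0 (0 :: nseq k 0) i).+1 =
            \prod_(i < k) nth_prime i ^ (nth 0 (nseq k 0) i).+1.
    by apply: eq_bigr => i _; rewrite !(nth_nseq _ k.+1) nth_nseq !if_same.
  rewrite -[ltnLHS]muln1 ltn_pmul2l.
    by rewrite -(exp1n (nth 0 (0 :: nseq k 0) k).+1) ltn_exp2r
      ?prime_gt1 ?nth_prime_prime.
  by rewrite prodn_gt0 // => j; rewrite expn_gt0 prime_gt0 ?nth_prime_prime.
have rank0 k : k <= code_rank (seq_code (nseq k 0)).
  elim: k => // k IHk; apply: leq_ltn_trans IHk (code_rank_incr _ (code0S k)).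
  by eexists.
apply: leq_trans (rank0 _) (code_rank_le _).
rewrite /seq_code size_nseq; apply: leq_prod => i _.
by rewrite leq_exp2l ?prime_gt1 ?nth_prime_prime // nth_nseq if_same.
Qed.

Lemma size_s_omega n : size (s_omega n) = n.
Proof. by rewrite size_cat size_nseq subnKC // size_psi. Qed.

(* Main.v *)
Require Import Defs.
From mathcomp Require Import all_boot all_order all_algebra.
From mathcomp Require Import all_classical all_reals topology measure.
From mathcomp Require Import lra.

(** The two alternatives exclude each other by Baire category. Composing the two
    reductions colors the sequence space with countably many sets having the
    Baire property; one of them is comeager in some cylinder, the stems being
    dense, hence comeager in a cylinder around a stem, and it then contains all
    the points of an edge of [A_omega] ([comeager_edge],
    [reductions_exclusive]).

    For existence, call a set of points independent if no element of [A] has all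
    its coordinates in it. If the space is a countable union of Borel independent
    sets, the least index of a set containing the point is a reduction to
    [not_diagonal] ([colorable_reducible]). Suppose it is not. The homomorphism
    from [A_omega] is approximated by configurations: labellings of all the
    sequences of length [n] by points, and of the edges of [A_omega] below level
    [n] by parameters of elements of [A] that witness the edge relations. A
    prescription fixes, for each level up to [n], finitely many digits of the
    code of every copy of that level. As there are countably many prescriptions,
    one countable union [Z] of Borel independent sets meets every configuration
    of each prescription that can be killed in this way
    ([universal_null_set]). For a prescription that survives, the points found
    at the stem of length [n], over the configurations avoiding [Z], form a
    Souslin set. It is not independent: a Souslin independent set is contained in
    a Borel one ([independent_separation], a form of the Novikov separation
    theorem), which could be added to [Z]. So [A] has an edge between such
    points, and this edge glues infinitely many configurations into one of the
    next level ([good_extend]). Iterating, and fixing more and more digits at the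
    stems, one obtains a sequence of configurations whose labels converge along
    every sequence that passes through infinitely many stems, and the limit is a
    continuous homomorphism on a comeager set ([uncolorable_reducible]).

    The remaining sequences form a meager set, on which the map may take any
    values as far as measurability goes. Since [A_omega] is acyclic, each
    tail-equivalence class there can be mapped to [A] edge after edge, within the
    image of the comeager set ([tree_hom], [baire_reducible_generic]). *)

Set Implicit Arguments.
Unset Strict Implicit.
Unset Printing Implicit Defensive.

Import Order.TTheory GRing.Theory Num.Theory.

Local Open Scope classical_set_scope.

(** * The topology of sequence spaces *)

Definition agree (n : nat) (f g : nat -> nat) : Prop :=
  forall i, i < n -> f i = g i.

Lemma agree_sym n f g : agree n f g -> agree n g f.
Proof. by move=> fg i /fg. Qed.

Lemma agree_trans n f g h : agree n f g -> agree n g h -> agree n f h.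
Proof. by move=> fg gh i lt_in; rewrite fg // gh. Qed.

Lemma agree_le m n f g : m <= n -> agree n f g -> agree m f g.
Proof. by move=> le_mn fg i lt_im; apply: fg; exact: leq_trans le_mn. Qed.

Lemma coord_continuous (T : topologicalType) (i : nat) :
  continuous ((fun y => y i) : pow_omega T -> T).
Proof. exact: (@proj_continuous nat (fun=> T) i). Qed.

Lemma coord_comp_continuous (S T : topologicalType) (f : S -> pow_omega T)
    (i : nat) : continuous f -> continuous (fun y => f y i).
Proof.
move=> cf y U /= nU; have h := @coord_continuous T i (f y) U nU.
exact: (cf y _ h).
Qed.

Lemma nbhs_baire (y : baire_space) (A : set baire_space) :
  nbhs y A <-> exists n, forall z, agree n y z -> A z.
Proof.
split=> [|[n]].
  pose F : set_system baire_space :=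
    [set B | exists n, forall z, agree n y z -> B z].
  have FF : Filter F.
    split=> [|B C [m Bm] [n Cn]|B C BC [n Bn]].
    - by exists 0.
    - exists (maxn m n) => z yz; split.
        by apply/Bm/(agree_le _ yz)/leq_maxl.
      by apply/Cn/(agree_le _ yz)/leq_maxr.
    - by exists n => z /Bn /BC.
  suff : F --> y by apply.
  apply/cvg_sup => i U [V] [[W] oW <-] Wy WU.
  by exists i.+1 => z yz; apply: WU; rewrite /= -yz.
elim: n A => [|n IHn] A AP; first by apply: filterS filterT => z _; exact: AP.
have h1 := IHn [set z | agree n y z] (fun z yz => yz).
have h2 : nbhs y [set z : baire_space | z n = y n].
  apply: (@coord_continuous nat n y [set k | k = y n]).
  by rewrite nbhs_principalE; apply/principal_filterP.
apply: filterS (filterI h1 h2) => z [yz zn]; apply: AP => i.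
by rewrite ltnS leq_eqVlt => /predU1P[->|/yz].
Qed.

Lemma continuous_baire (T : topologicalType) (f : baire_space -> T) :
  continuous f <->
  forall y U, open U -> U (f y) -> exists n, forall z, agree n y z -> U (f z).
Proof.
split=> [cf y U oU Ufy|cf y U].
  by have /nbhs_baire := cf y U (open_nbhs_nbhs (conj oU Ufy)).
rewrite nbhsE => -[V [oV Vfy] VU]; apply/nbhs_baire.
by have [n nV] := cf y V oV Vfy; exists n => z /nV /VU.
Qed.

Lemma open_baire (U : set baire_space) :
  open U <-> forall y, U y -> exists n, forall z, agree n y z -> U z.
Proof.
split=> [oU y Uy|h]; first exact/nbhs_baire/open_nbhs_nbhs.
by rewrite openE => y /h; rewrite /interior => /nbhs_baire.
Qed.

Lemma closed_baire (K : set baire_space) :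
  closed K <-> forall y, (forall n, exists2 z, agree n y z & K z) -> K y.
Proof.
split=> [cK y h|h].
  apply: cK => B /nbhs_baire[n nB]; have [z yz Kz] := h n.
  by exists z; split=> //; exact: nB.
rewrite -openC; apply/open_baire => y /= nKy; apply: contrapT => no.
apply/nKy/h => n; apply: contrapT => no2; apply: no; exists n => z yz Kz.
by apply: no2; exists z.
Qed.

(** Uniform continuity for the prefix metric. All the decoding maps below
    satisfy it, and it composes without any choice of points. *)
Definition finitary (h : (nat -> nat) -> (nat -> nat)) : Prop :=
  forall n, exists m, forall y z, agree m y z -> agree n (h y) (h z).

Lemma finitary_id : finitary (fun y => y).
Proof. by move=> n; exists n. Qed.

Lemma finitary_comp g h : finitary g -> finitary h -> finitary (g \o h).
Proof.
by move=> fg fh n; have [m mP] := fg n; have [p pP] := fh m; exists p => y z /pP/mP.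
Qed.

Lemma finitary_reindex (p : nat -> nat) : finitary (fun y i => y (p i)).
Proof.
elim=> [|n [m mP]]; first by exists 0.
exists (maxn m (p n).+1) => y z yz i; rewrite ltnS leq_eqVlt => /predU1P[->|].
  by apply: yz; rewrite leq_max leqnn orbT.
by apply: mP; apply: agree_le yz; exact: leq_maxl.
Qed.

Lemma finitary_continuous h :
  finitary h -> continuous (h : baire_space -> baire_space).
Proof.
move=> fh; apply/continuous_baire => y U oU Uhy.
have [n nU] := (open_baire U).1 oU _ Uhy; have [m mP] := fh n.
by exists m => z /mP /nU.
Qed.

(** * Baire category *)

Lemma nowhere_dense_baire (F : set baire_space) :
  nowhere_dense F <->
  forall y n, exists z m, agree n y z /\ forall x, agree m z x -> ~ F x.
Proof.
split=> [nF y n|h].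
  have : ~ interior (closure F) y by rewrite nF.
  rewrite /interior nbhs_baire => no; apply: contrapT => h; apply: no.
  exists n => z yz B /nbhs_baire[m mB]; apply: contrapT => FB; apply: h.
  by exists z, m; split=> // x /mB Bx Fx; apply: FB; exists x.
rewrite /nowhere_dense -subset0 => y; rewrite /interior => /nbhs_baire[n nF].
have [z [m [/nF Fz zF]]] := h y n.
have [|x [Fx zx]] := Fz [set x | agree m z x]; first by apply/nbhs_baire; exists m.
exact: zF zx Fx.
Qed.

(** The usual nested-neighbourhood construction; the lengths of the chosen
    prefixes strictly increase, so that the prefixes have a limit. *)
Lemma baire_category (F : nat -> set baire_space) :
  (forall k, nowhere_dense (F k)) ->
  forall y n, exists z, agree n y z /\ forall k, ~ F k z.
Proof.
move=> nF y n.
have stepP k (p : (nat -> nat) * nat) : exists q : (nat -> nat) * nat,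
    [/\ agree p.2 p.1 q.1, p.2 < q.2 & forall x, agree q.2 q.1 x -> ~ F k x].
  have [z [m [pz zF]]] := (nowhere_dense_baire _).1 (nF k) p.1 p.2.
  exists (z, maxn m p.2.+1); split=> //=; first by rewrite leq_maxr.
  by move=> x zx; apply: zF; apply: agree_le zx; exact: leq_maxl.
have [st stP] := choice (fun kp => stepP kp.1 kp.2).
pose p := fix p k := if k is k'.+1 then st (k', p k') else (y, n).
have pS k : [/\ agree (p k).2 (p k).1 (p k.+1).1, (p k).2 < (p k.+1).2 &
    forall x, agree (p k.+1).2 (p k.+1).1 x -> ~ F k x].
  exact: (stP (k, p k)).
have p_ge k : k <= (p k).2.
  by elim: k => // k IHk; have [_ h _] := pS k; exact: leq_ltn_trans IHk h.
have p_chain k d : (p k).2 <= (p (k + d)).2 /\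
    agree (p k).2 (p k).1 (p (k + d)).1.
  elim: d => [|d [le IHd]]; first by rewrite addn0.
  rewrite addnS; have [h1 h2 _] := pS (k + d); split.
    exact: leq_trans le (ltnW h2).
  by apply: agree_trans IHd _; exact: agree_le h1.
pose z i := (p i.+1).1 i.
have p_lim k : agree (p k).2 (p k).1 z.
  move=> i ik; rewrite /z; case: (leqP k i.+1) => [/subnKC <-|/ltnW/subnKC <-].
    exact: (p_chain k _).2.
  by rewrite -(p_chain i.+1 (k - i.+1)).2 // p_ge.
exists z; split; first exact: (p_lim 0).
by move=> k; have [_ _ h] := pS k; apply/h/p_lim.
Qed.

Section Meager.
Variable T : topologicalType.
Implicit Types A B : set T.

Lemma nowhere_denseS A B : A `<=` B -> nowhere_dense B -> nowhere_dense A.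
Proof.
rewrite /nowhere_dense -!subset0 => AB nB.
by apply: subset_trans nB; apply/interiorS/closureS.
Qed.

Lemma meagerS A B : A `<=` B -> meager B -> meager A.
Proof.
move=> AB [F nF BF]; exists (fun n => F n `&` A).
  by move=> n; apply: nowhere_denseS (nF n) => x [].
rewrite -setI_bigcupl -BF; apply/seteqP; split=> x //; last by case.
by move=> Ax; split=> //; exact: AB.
Qed.

Lemma nowhere_dense_meager A : nowhere_dense A -> meager A.
Proof.
by move=> nA; exists (fun=> A) => //; apply/seteqP; split=> x; [exists 0|case].
Qed.

Lemma meager_bigcup (F : nat -> set T) :
  (forall n, meager (F n)) -> meager (\bigcup_n F n).
Proof.
move=> mF; have h n : exists G : nat -> set T,
    (forall k, nowhere_dense (G k)) /\ F n = \bigcup_k G k.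
  by have [G] := mF n; exists G.
have [G GP] := choice h.
exists (fun m => if unpickle m is Some (n, k) then G n k else set0).
  move=> m; case: (unpickle m) => [[n k]|]; first exact: (GP n).1.
  by rewrite /nowhere_dense closure0 interior0.
apply/seteqP; split=> x.
  move=> [n _]; rewrite (GP n).2 => -[k _ Gx].
  by exists (pickle (n, k)) => //=; rewrite pickleK.
move=> [m _]; case: (unpickle m) => [[n k]|] // Gx.
by exists n => //; rewrite (GP n).2; exists k.
Qed.

Lemma meagerU A B : meager A -> meager B -> meager (A `|` B).
Proof.
move=> mA mB; rewrite -bigcup2E; apply: meager_bigcup => -[|[|n]] //=.
by apply: nowhere_dense_meager; rewrite /nowhere_dense closure0 interior0.
Qed.

(** The complement of an open set differs from its interior by the boundary,
    which is closed without interior. *)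
Lemma baire_propertyC A : baire_property A -> baire_property (~` A).
Proof.
move=> [U oU mAU]; exists (~` closure U).
  by rewrite openC; exact: closed_closure.
have mD : meager (closure U `\` U).
  apply: nowhere_dense_meager; rewrite /nowhere_dense -subset0 => x.
  have cD : closed (closure U `\` U).
    by apply: closedI; [exact: closed_closure | rewrite closedC].
  rewrite -((closure_id _).1 cD) /interior => h; have [Ux _] := nbhs_singleton h.
  by have [y [Uy []]] := Ux _ h.
apply: meagerS (meagerU mAU mD) => x [[nAx /contrapT Ux]|[nUx /contrapT Ax]].
  by have [Ux'|nUx] := pselect (U x); [left; right|right].
by left; left; split=> // Ux; apply: nUx; exact: subset_closure.
Qed.

Lemma baire_property_bigcup (F : nat -> set T) :
  (forall n, baire_property (F n)) -> baire_property (\bigcup_n F n).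
Proof.
move=> bF; have h n : exists U, open U /\ meager (F n `+` U).
  by have [U] := bF n; exists U.
have [U UP] := choice h.
exists (\bigcup_n U n); first by apply: bigcup_open => n _; exact: (UP n).1.
apply: meagerS (meager_bigcup (fun n => (UP n).2)).
move=> x [[[n _ Fx] nU]|[[n _ Ux] nF]]; exists n => //; [left|right]; split=> //.
  by move=> Ux; apply: nU; exists n.
by move=> Fx; apply: nF; exists n.
Qed.

Lemma open_baire_property A : open A -> baire_property A.
Proof.
move=> oA; exists A => //; apply: nowhere_dense_meager.
rewrite (_ : _ `+` _ = set0); first by rewrite /nowhere_dense closure0 interior0.
by apply/seteqP; split=> x // [[]|[]].
Qed.

End Meager.

Lemma baire_measurable_borel (X Y : topologicalType) (u : X -> Y) :
  baire_measurable_map u -> forall B, borel B -> baire_property (u @^-1` B).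
Proof.
move=> mu; apply: smallest_sub => [|B oB]; last exact: mu.
split=> [|B bB|F bF].
- by rewrite /= preimage_set0; apply: open_baire_property; exact: open0.
- by rewrite setTD /= preimage_setC; exact: baire_propertyC.
- by rewrite /= preimage_bigcup; exact: baire_property_bigcup.
Qed.

(** * Generic sequences *)

Definition stem (n : nat) : nat -> nat := nth 0 (s_omega n).

Lemma stem_dense (f : nat -> nat) (k : nat) :
  exists2 n, k <= n & agree k (stem n) f.
Proof.
exists (code_rank (seq_code (mkseq f k))).
  by rewrite -{1}(size_mkseq f k) -{1}(rank_codeK (mkseq f k)) size_psi.
move=> i ik; rewrite /stem /s_omega rank_codeK nth_cat size_mkseq ik.
by rewrite nth_mkseq.
Qed.

Definition edge_point (n i : nat) (g : nat -> nat) : nat -> nat :=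
  concat (rcons (s_omega n) i) g.

Lemma edge_pointE n i g p :
  edge_point n i g p =
  if p < n then stem n p else if p == n then i else g (p - n.+1).
Proof.
rewrite /edge_point /concat size_rcons size_s_omega nth_rcons size_s_omega.
by rewrite ltnS; case: (ltngtP p n).
Qed.

Lemma edge_point_stem n i g : agree n (edge_point n i g) (stem n).
Proof. by move=> p pn; rewrite edge_pointE pn. Qed.

Lemma edge_point_diag n i g : edge_point n i g n = i.
Proof. by rewrite edge_pointE ltnn eqxx. Qed.

Lemma edge_point_tail n i j g p :
  n < p -> edge_point n i g p = edge_point n j g p.
Proof. by move=> np; rewrite !edge_pointE; case: ltngtP np. Qed.

Lemma edge_point_eq n i y :
  agree n y (stem n) -> y n = i -> y = edge_point n i (fun p => y (p + n.+1)).
Proof.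
move=> yn yi; apply/funext => p; rewrite edge_pointE.
by case: (ltngtP p n) => [/yn|h|->] //; rewrite subnK.
Qed.

(** Some [stem n] cylinder lies inside [U]. In it, the tails [g] whose [i]-th
    edge point falls outside [C] form a meager set, and there are only countably
    many positions [i], so some tail keeps the whole edge in [C]. *)
Lemma comeager_edge (C : set baire_space) (U : set baire_space) (F : nat -> set baire_space) :
  open U -> U !=set0 -> (forall k, nowhere_dense (F k)) ->
  U `\` C `<=` \bigcup_k F k ->
  exists n g, forall i, C (edge_point n i g).
Proof.
move=> oU [y Uy] nF UC; have [k kU] := (open_baire U).1 oU y Uy.
have [n kn yn] := stem_dense y k; exists n.
pose G m : set baire_space :=
  if unpickle m is Some (i, j) then [set g | F j (edge_point n i g)] else set0.
have nG m : nowhere_dense (G m).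
  rewrite /G; case: (unpickle m) => [[i j]|]; last first.
    by rewrite /nowhere_dense closure0 interior0.
  apply/nowhere_dense_baire => g l.
  have [z [q [gz zF]]] :=
    (nowhere_dense_baire _).1 (nF j) (edge_point n i g) (l + n.+1).
  have zE : z = edge_point n i (fun p => z (p + n.+1)).
    apply: edge_point_eq => [p pn|].
      by rewrite -gz ?edge_point_stem // addnS ltnS (leq_trans (ltnW pn)) // leq_addl.
    by rewrite -gz ?edge_point_diag // addnS ltnS leq_addl.
  exists (fun p => z (p + n.+1)), q; split=> [p pl|x zx].
    rewrite -gz ?ltn_add2r // edge_pointE ltnNge (leq_trans (leqnSn n)) ?leq_addl //=.
    by rewrite gtn_eqF ?leq_addl // addnK.
  apply: zF => p pq; rewrite zE !edge_pointE; case: (ltngtP p n) => // np.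
  by apply: zx; exact: leq_ltn_trans (leq_subr _ _) pq.
have [g [_ gG]] := baire_category nG (fun=> 0) 0.
exists g => i; apply: contrapT => nC; have [//|j _ Fj] := UC (edge_point n i g).
  split=> //; apply: kU; apply: agree_sym; apply: agree_trans yn.
  by apply: agree_le kn _; exact: edge_point_stem.
by apply: (gG (pickle (i, j))); rewrite /G pickleK.
Qed.

Lemma reductions_exclusive (X : topologicalType) (A : set (pow_omega X)) :
  borel_reducible A not_diagonal -> baire_reducible A_omega A -> False.
Proof.
move=> [c bc Ac] [u mu Au].
have bp k : baire_property (u @^-1` (c @^-1` [set k])).
  apply: baire_measurable_borel mu _ _; apply: bc; apply: sub_sigma_algebra.
  exact: discrete_open.
have h k : exists U : set baire_space,
    open U /\ meager (u @^-1` (c @^-1` [set k]) `+` U).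
  by have [U] := bp k; exists U.
have [U UP] := choice h.
have [[k Uk]|noU] := pselect (exists k, U k !=set0).
  have [F nF UF] := (UP k).2.
  have [|n [g gP]] := comeager_edge (C := u @^-1` (c @^-1` [set k]))
    (UP k).1 Uk nF; first by rewrite -UF => y [Uy ny]; right.
  have Ag : A_omega (fun i => edge_point n i g) by exists n, g.
  by apply: (Ac _ (Au _ Ag)) => i; have:= gP i; have:= gP 0; rewrite /= /map_omega => -> ->.
have [F nF TF] := meager_bigcup (fun k => (UP k).2).
have [y [_ yF]] := baire_category nF (fun=> 0) 0.
have : (\bigcup_n F n) y.
  rewrite -TF; exists (c (u y)) => //; left; split=> // Uy.
  by apply: noU; exists (c (u y)), y.
by move=> [n _ Fy]; apply: yF Fy.
Qed.

Definition overwrite (t : seq nat) (y : nat -> nat) : nat -> nat :=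
  fun p => if p < size t then nth 0 t p else y p.

(** Passing through infinitely many stems makes the approximations of the
    homomorphism converge; the prescribed digit [j] after the stem puts each
    generic sequence on an edge of [A_omega] in every position; and asking this
    of all finite modifications makes the notion depend on the tail only, so that
    an edge is either entirely generic or entirely non-generic. *)
Definition generic : set baire_space := [set y | forall t j k,
  exists2 n, k <= n & agree n (overwrite t y) (stem n) /\ overwrite t y n = j].

Lemma generic_tail y z N :
  (forall p, N <= p -> y p = z p) -> generic y -> generic z.
Proof.
move=> yz gy t j k; pose M := maxn N (size t).
have -> : overwrite t z = overwrite (mkseq (overwrite t z) M) y.
  apply/funext => p; rewrite {2}/overwrite size_mkseq.
  case: (ltnP p M) => pM; first by rewrite nth_mkseq.
  rewrite /overwrite ltnNge (leq_trans _ pM) ?leq_maxr //= yz //.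
  by apply: leq_trans pM; exact: leq_maxl.
exact: gy.
Qed.

Lemma generic_comeager : meager (~` generic).
Proof.
pose F (q : seq nat * nat * nat) : set baire_space := [set y | forall n, q.2 <= n ->
  ~ (agree n (overwrite q.1.1 y) (stem n) /\ overwrite q.1.1 y n = q.1.2)].
apply: (@meagerS _ _ (\bigcup_m (if unpickle m is Some q then F q else set0))).
  move=> y /existsNP[t] /existsNP[j] /existsNP[k] no.
  exists (pickle (t, j, k)) => //=; rewrite pickleK => n kn h.
  by apply: no; exists n.
apply: meager_bigcup => m; case: (unpickle m) => [[[t j] k]|]; last first.
  by apply: nowhere_dense_meager; rewrite /nowhere_dense closure0 interior0.
apply/nowhere_dense_meager/nowhere_dense_baire => y l.
pose N := maxn (maxn l k) (size t).
have [n Nn sn] := stem_dense (overwrite t y) N.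
have tn : size t <= n by apply: leq_trans Nn; exact: leq_maxr.
(* Overwriting [z] with [t] follows the stem up to [n], where it takes the value [j]. *)
pose z p := if p < size t then y p else if p == n then j else stem n p.
exists z, n.+1; split=> [p pl|x zx].
  have pN : p < N by rewrite !leq_max pl.
  rewrite /z; case: (ltnP p (size t)) => // tp.
  by rewrite ltn_eqF ?(leq_trans pN) // sn // /overwrite ltnNge tp //.
move=> /(_ n) /=; apply; first by apply: leq_trans Nn; rewrite !leq_max leqnn orbT.
split=> [p pn|].
  rewrite /overwrite; case: (ltnP p (size t)) => tp.
    by rewrite sn ?/overwrite ?tp // leq_max tp orbT.
  by rewrite -zx ?ltnS ?(ltnW pn) // /z ltnNge tp /= (ltn_eqF pn).
by rewrite /overwrite ltnNge tn /= -zx // /z ltnNge tn eqxx.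
Qed.

Lemma generic_nonempty : generic !=set0.
Proof.
have [F nF GF] := generic_comeager.
have [y [_ yF]] := baire_category nF (fun=> 0) 0.
exists y; apply: contrapT => ny.
by have [k _] : (\bigcup_n F n) y; [rewrite -GF|exact: yF].
Qed.

Lemma generic_stem y k : generic y -> exists2 n, k <= n & agree n y (stem n).
Proof. by move=> /(_ [::] 0 k)[n kn [yn _]]; exists n. Qed.

(** * From the generic sequences to all sequences *)

Section TreeHomomorphism.
Variables (X : Type) (A : set (nat -> X)) (P : set X).
Variable e : X * nat -> nat -> X.
Hypothesis eP : forall x j, P x ->
  [/\ A (e (x, j)), e (x, j) j = x & forall i, P (e (x, j) i)].

(** On the first [m] digits, the edges of [A_omega] form an acyclic hypergraph:
    level [m.+1] consists of disjoint copies of level [m] hung along one edge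
    through the copies of [stem m]. This homomorphism sends [a] to [x]; the
    other copies are rooted at their [stem m], on an edge of [A] through the
    image of the [stem m] of the copy of [a]. *)
Fixpoint tree_hom (m : nat) (a : nat -> nat) (x : X) (b : nat -> nat) : X :=
  if m is m'.+1 then
    if b m' == a m' then tree_hom m' a x b
    else tree_hom m' (stem m') (e (tree_hom m' a x (stem m'), a m') (b m')) b
  else x.

Lemma tree_hom_root m a x : tree_hom m a x a = x.
Proof. by elim: m => //= m ->; rewrite eqxx. Qed.

Lemma tree_hom_ext m a x b c :
  agree m b c -> tree_hom m a x b = tree_hom m a x c.
Proof.
elim: m a x => //= m IHm a x bc; rewrite bc //.
by rewrite !(IHm _ _ (agree_le (leqnSn m) bc)).
Qed.

Lemma tree_hom_in m a x b : P x -> P (tree_hom m a x b).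
Proof.
elim: m a x b => [|m IHm] a x b Px //=; case: eqP => _; first exact: IHm.
by apply: (IHm); have [_ _] := eP (a m) (IHm a x (stem m) Px); apply.
Qed.

Lemma tree_hom_stable m n a x b :
  m <= n -> (forall p, m <= p -> a p = b p) ->
  tree_hom n a x b = tree_hom m a x b.
Proof.
move=> /subnKC <- ab; elim: (n - m) => [|d IHd]; first by rewrite addn0.
by rewrite addnS /= ab ?leq_addr // eqxx.
Qed.

Lemma tree_hom_edge m n a x g :
  n < m -> P x -> A (fun i => tree_hom m a x (edge_point n i g)).
Proof.
elim: m a x => // m IHm a x; rewrite ltnS leq_eqVlt => /predU1P[->|nm] Px /=.
  have Py : P (tree_hom m a x (stem m)) by exact: tree_hom_in.
  have [Ae ea _] := eP (a m) Py.
  suff -> : (fun i => if edge_point m i g m == a m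
      then tree_hom m a x (edge_point m i g)
      else tree_hom m (stem m) (e (tree_hom m a x (stem m), a m)
        (edge_point m i g m)) (edge_point m i g)) =
    e (tree_hom m a x (stem m), a m) by [].
  apply/funext => i; rewrite edge_point_diag.
  rewrite !(tree_hom_ext _ _ (@edge_point_stem m i g)) tree_hom_root.
  by case: eqP => // ->.
have tl i : edge_point n i g m = edge_point n 0 g m by exact: edge_point_tail.
under eq_fun do rewrite tl.
case: (eqVneq (edge_point n 0 g m) (a m)) => _; first exact: IHm.
apply: (IHm) => //; have [_ _] := eP (a m) (tree_hom_in m a (stem m) Px).
exact.
Qed.

End TreeHomomorphism.

Definition tail_eq (y z : nat -> nat) : Prop :=
  exists N, forall p, N <= p -> y p = z p.

Lemma tail_eq_trans x y z : tail_eq x y -> tail_eq y z -> tail_eq x z.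
Proof.
move=> [M xy] [N yz]; exists (maxn M N) => p; rewrite geq_max => /andP[Mp Np].
by rewrite xy ?yz.
Qed.

Lemma tail_eq_sym y z : tail_eq y z -> tail_eq z y.
Proof. by move=> [N yz]; exists N => p /yz. Qed.

Definition tail_repr (y : nat -> nat) : nat -> nat :=
  xget (fun=> 0) [set z | tail_eq z y].

Lemma tail_reprP y : tail_eq (tail_repr y) y.
Proof.
rewrite /tail_repr; case: xgetP => [z _ //|/(_ y) no].
by exfalso; apply: no; exists 0.
Qed.

Lemma tail_repr_eq y z : tail_eq y z -> tail_repr y = tail_repr z.
Proof.
move=> yz; rewrite /tail_repr; congr xget; apply/seteqP; split=> x /= h.
  exact: tail_eq_trans yz.
by apply: tail_eq_trans h _; exact: tail_eq_sym.
Qed.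

(** The values off the comeager set [generic] do not affect measurability, but
    every edge of [A_omega] has to be mapped to [A]. On a tail-equivalence class
    disjoint from [generic], [A_omega] is an acyclic hypergraph, and each image
    of a generic sequence lies, in any prescribed position, on an edge of [A]
    between such images; hence the class can be mapped edge after edge. *)
Lemma baire_reducible_generic (X : topologicalType) (A : set (pow_omega X))
    (u0 : baire_space -> X) :
  (forall n g, (forall i, generic (edge_point n i g)) ->
    A (fun i => u0 (edge_point n i g))) ->
  (forall V, open V -> exists2 U : set baire_space, open U &
    forall y, generic y -> V (u0 y) <-> U y) ->
  baire_reducible A_omega A.
Proof.
move=> u0A u0V; pose P : set X := u0 @` generic.
have edgeP (q : X * nat) : exists e : nat -> X, P q.1 ->
    [/\ A e, e q.2 = q.1 & forall i, P (e i)].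
  have [Pq|nP] := pselect (P q.1); last by exists (fun=> q.1) => /nP.
  have [y gy yq] := Pq.
  have [n _] := gy [::] q.2 0; rewrite (_ : overwrite [::] y = y) // => -[yn yj].
  have yE := edge_point_eq yn yj; set g := (fun p => _) in yE.
  have gi i : generic (edge_point n i g).
    apply: (generic_tail (N := n.+1) _ gy) => p np.
    by rewrite yE; exact: edge_point_tail.
  exists (fun i => u0 (edge_point n i g)) => _.
  split; [exact: u0A|by rewrite -yE|by move=> i; exists (edge_point n i g)].
have [e eP'] := choice edgeP.
have eP x j : P x -> [/\ A (e (x, j)), e (x, j) j = x & forall i, P (e (x, j) i)].
  exact: (eP' (x, j)).
have [y0 gy0] := generic_nonempty.
have Px : P (u0 y0) by exists y0.
have [len lenP] := choice tail_reprP.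
pose u y := if pselect (generic y) then u0 y
            else tree_hom e (len y) (tail_repr y) (u0 y0) y.
have uE y m : ~ generic y -> (forall p, m <= p -> tail_repr y p = y p) ->
    u y = tree_hom e m (tail_repr y) (u0 y0) y.
  move=> ny ym; rewrite /u; case: pselect => [//|? /=].
  rewrite -(tree_hom_stable e (u0 y0) (leq_maxl m (len y)) ym).
  by rewrite -(tree_hom_stable e (u0 y0) (leq_maxr m (len y)) (lenP y)).
exists u => [V oV|_ [n [g ->]]].
  have [U oU UV] := u0V V oV; exists U => //.
  apply: meagerS generic_comeager => y; rewrite /= /u.
  by case: pselect => [gy|//]; have [VU UV'] := UV y gy; case=> -[] //; tauto.
change (A (fun i => u (edge_point n i g))).
have tl i : tail_eq (edge_point n i g) (edge_point n 0 g).
  by exists n.+1 => p np; exact: edge_point_tail.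
have [g0|ng0] := pselect (generic (edge_point n 0 g)).
  have gi i : generic (edge_point n i g).
    have [N NP] := tl i; apply: generic_tail g0 => p Np.
    by rewrite -NP //; exact: Np.
  rewrite (_ : (fun i => _) = fun i => u0 (edge_point n i g)); first exact: u0A.
  by apply/funext => i; rewrite /u; case: pselect.
have ngi i : ~ generic (edge_point n i g).
  by move=> gi; apply: ng0; have [N NP] := tl i; exact: (generic_tail NP gi).
set a := tail_repr (edge_point n 0 g).
have [m aP] := tail_reprP (edge_point n 0 g).
pose M := maxn m n.+1.
rewrite (_ : (fun i => _) = fun i => tree_hom e M a (u0 y0) (edge_point n i g)).
  by apply: (tree_hom_edge eP) => //; exact: leq_maxr.
apply/funext => i; rewrite (uE _ M) ?(tail_repr_eq (tl i)) // => p.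
rewrite geq_max => /andP[mp np].
by rewrite aP //; exact: edge_point_tail.
Qed.

(** * Polish spaces as continuous images of the sequence space *)

Section PolishImage.
Local Open Scope ring_scope.
Variables (R : realType) (T : topologicalType) (d : T -> T -> R).
Hypotheses (dm : is_metric d) (dc : compatible_metric d) (dC : complete_metric d).

Let d0 x : d x x = 0.
Proof. by have [h _ _] := dm; apply/h. Qed.

Let dsym x y : d x y = d y x.
Proof. by have [_ h _] := dm; exact: h. Qed.

Let dtri y x z : d x z <= d x y + d y z.
Proof. by have [_ _ h] := dm; exact: h. Qed.

Let nbhs_d x (A : set T) :
  nbhs x A <-> exists2 e : R, 0 < e & forall z, d x z < e -> A z.
Proof. by rewrite dc; split=> -[e e0 eA]; exists e. Qed.

Let d_ge0 x y : 0 <= d x y.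
Proof. by have := dtri y x x; rewrite d0 (dsym y x); lra. Qed.

Lemma metric_hausdorff : hausdorff_space T.
Proof.
move=> x y xy; have [h _ _] := dm; apply/h/eqP; rewrite eq_le d_ge0 andbT.
rewrite leNgt; apply/negP => dxy.
have e0 : 0 < d x y / 2 by lra.
have [||z /= [xz yz]] := xy [set z | d x z < d x y / 2] [set z | d y z < d x y / 2].
- by apply/nbhs_d; exists (d x y / 2).
- by apply/nbhs_d; exists (d x y / 2).
- by have := dtri z x y; rewrite (dsym z y); lra.
Qed.

Let r n : R := 2^-1 ^+ n.

Let r_gt0 n : 0 < r n.
Proof. by apply: exprn_gt0; lra. Qed.

Let rS n : r n = 2 * r n.+1.
Proof. by rewrite /r exprS mulrA mulfV ?mul1r // pnatr_eq0. Qed.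

Let r_small (e : R) : 0 < e -> exists n, r n < e.
Proof.
move=> e0; exists (Num.bound e^-1).
have eb : e^-1 < (Num.bound e^-1)%:R.
  by apply: archi_boundP; rewrite invr_ge0 ltW.
rewrite /r exprVn invf_plt ?posrE ?exprn_gt0 //; apply: lt_trans eb _.
by rewrite -natrX ltr_nat ltn_expl.
Qed.

Section Enumeration.
Variable q : nat -> T.
Hypothesis q_dense : forall x (e : R), 0 < e -> exists n, d x (q n) < e.

(** The points designated by [y], with the jumps that are too long cancelled:
    this makes every [y] designate a Cauchy sequence. *)
Let approx (y : nat -> nat) := fix approx n : T :=
  if n is m.+1 then
    if d (approx m) (q (y n)) < r n then q (y n) else approx m
  else q (y 0%N).

Let approx_chain y n k :
  d (approx y n) (approx y (n + k)%N) <= r n - r (n + k)%N.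
Proof.
elim: k => [|k IHk]; first by rewrite addn0 d0 subrr.
rewrite addnS; have rk := rS (n + k).
have : d (approx y (n + k)%N) (approx y (n + k).+1) <= r (n + k).+1.
  by rewrite /=; case: ifP => [/ltW //|_]; rewrite d0 ltW.
by have := dtri (approx y (n + k)%N) (approx y n) (approx y (n + k).+1); lra.
Qed.

Let approx_cvg (y : nat -> nat) : exists l : T, approx y @ \oo --> l.
Proof.
apply: dC => e e0; have [N rN] : exists n, r n < e / 2 by apply: r_small; lra.
exists N => m n Nm Nn.
have := approx_chain y N (m - N); have := approx_chain y N (n - N).
rewrite !subnKC // => hm hn; have := dtri (approx y N) (approx y m) (approx y n).
by rewrite (dsym _ (approx y N)); have := r_gt0 m; have := r_gt0 n; lra.
Qed.

Let lim_approx := projT1 (choice approx_cvg).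

Let lim_approx_near y n : d (approx y n) (lim_approx y) <= r n.
Proof.
rewrite leNgt; apply/negP => h.
have yl : approx y @ \oo --> lim_approx y := projT2 (choice approx_cvg) y.
have e0 : 0 < d (approx y n) (lim_approx y) - r n by lra.
have [|N _ NP] := yl [set z | d (lim_approx y) z < d (approx y n) (lim_approx y) - r n].
  by apply/nbhs_d; exists (d (approx y n) (lim_approx y) - r n).
have /= := NP (n + N)%N (leq_addl _ _); rewrite dsym.
have := approx_chain y n N; have := r_gt0 (n + N).
by have := dtri (approx y (n + N)%N) (approx y n) (lim_approx y); lra.
Qed.

Let approx_agree y z n : agree n.+1 y z -> approx y n = approx z n.
Proof.
elim: n => [|n IHn] yz; first by rewrite /= yz.
by rewrite /= IHn ?(yz n.+1) //; exact: agree_le yz.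
Qed.

Let lim_approx_continuous : continuous (lim_approx : baire_space -> T).
Proof.
apply/continuous_baire => y U oU Uy.
have /nbhs_d[e e0 eU] := open_nbhs_nbhs (conj oU Uy).
have [n rn] : exists n, r n < e / 2 by apply: r_small; lra.
exists n.+1 => z yz; apply: eU.
have := lim_approx_near z n; have := lim_approx_near y n.
rewrite (approx_agree yz) (dsym _ (lim_approx y)).
by have := dtri (approx z n) (lim_approx y) (lim_approx z); lra.
Qed.

Let lim_approx_surj x : exists y, lim_approx y = x.
Proof.
(* The distances to [x] at ranks [n] and [n.+1] then add up to less than the
   permitted jump [r n.+1], so that no jump is cancelled. *)
have [y yP] := choice (fun n => q_dense x (r_gt0 n.+2)); exists y.
have yE n : approx y n = q (y n).
  elim: n => //= n ->; rewrite ifT //.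
  have := yP n; have := yP n.+1; have := dtri x (q (y n)) (q (y n.+1)).
  rewrite (dsym _ x); have := rS n.+1; have := rS n.+2.
  by have := r_gt0 n.+3; lra.
have [h _ _] := dm; apply/h/eqP; rewrite eq_le d_ge0 andbT.
rewrite leNgt; apply/negP => dxy.
have [n rn] : exists n, r n < d (lim_approx y) x / 2 by apply: r_small; lra.
have := lim_approx_near y n; rewrite yE dsym => h1; have := yP n.
have := dtri (q (y n)) (lim_approx y) x; rewrite (dsym (q (y n)) x).
by have := rS n; have := rS n.+1; have := r_gt0 n.+2; lra.
Qed.

Lemma dense_baire_image :
  exists2 f : baire_space -> T, continuous f & forall x, exists y, f y = x.
Proof. by exists lim_approx; [exact: lim_approx_continuous|exact: lim_approx_surj]. Qed.

End Enumeration.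

Lemma separable_enum (x0 : T) : separable T ->
  exists q : nat -> T, forall x (e : R), 0 < e -> exists n, d x (q n) < e.
Proof.
move=> [D /countable_injP[f f_inj] dD].
exists (fun n => xget x0 [set x | D x /\ f x = n]) => x e e0.
have : nbhs x [set z | d x z < e] by apply/nbhs_d; exists e.
rewrite nbhsE => -[U [oU Ux] Ue]; have [z [Uz Dz]] := dD U (ex_intro _ x Ux) oU.
exists (f z); case: xgetP => [y _ [Dy fy]|/(_ z)[]//].
by rewrite (f_inj y z) ?inE //; exact: Ue.
Qed.

End PolishImage.

Lemma polish_hausdorff (R : realType) (T : topologicalType) :
  polish R T -> hausdorff_space T.
Proof. by move=> [_ [d [dm dc _]]]; exact: metric_hausdorff dm dc. Qed.

Lemma polish_baire_image (R : realType) (T : topologicalType) (x0 : T) :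
  polish R T -> exists2 f : baire_space -> T,
    continuous f & forall x, exists y, f y = x.
Proof.
move=> [sT [d [dm dc dC]]]; have [q qP] := separable_enum dc x0 sT.
exact: (dense_baire_image dm dc dC qP).
Qed.

(** * Souslin sets *)

(** The analytic subsets of a Hausdorff space, in the parametrized form that the
    tree arguments below consume. Allowing a closed set of parameters rather
    than the whole sequence space accommodates the empty set and makes the
    closure under countable intersections immediate. *)
Definition souslin (T : topologicalType) (S : set T) : Prop :=
  exists K : set baire_space, exists g : baire_space -> T,
    [/\ closed K, continuous g & S = g @` K].

Definition rowseq (n : nat) (w : nat -> nat) : nat -> nat :=
  fun i => w (pickle (n, i)).

Lemma rowseq_finitary n : finitary (rowseq n).
Proof. exact: finitary_reindex. Qed.

Lemma rowseq_continuous n : continuous (rowseq n : baire_space -> baire_space).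
Proof. exact/finitary_continuous/rowseq_finitary. Qed.

Definition of_rows (W : nat -> nat -> nat) : nat -> nat :=
  fun m => if unpickle m is Some (n, i) then W n i else 0.

Lemma rowseq_of_rows n W : rowseq n (of_rows W) = W n.
Proof. by apply/funext => i; rewrite /rowseq /of_rows pickleK. Qed.

Lemma closed_preimage (S T : topologicalType) (f : S -> T) (K : set T) :
  continuous f -> closed K -> closed (f @^-1` K).
Proof. by move=> cf cK; apply: closed_comp => // x _; exact: cf. Qed.

Lemma continuous_comp_baire (T : topologicalType) (f : baire_space -> T)
    (h : baire_space -> baire_space) :
  continuous h -> continuous f -> continuous (fun y => f (h y)).
Proof. by move=> ch cf y; apply: continuous_comp; [exact: ch|exact: cf]. Qed.

Lemma hausdorff_open (T : topologicalType) (x y : T) :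
  hausdorff_space T -> x <> y ->
  exists U V, [/\ open U, open V, U x, V y & U `&` V = set0].
Proof.
rewrite open_hausdorff => hT /eqP xy; have [[U V] /= [Ux Vy] [oU oV UV]] := hT x y xy.
by exists U, V; split=> //; rewrite -inE.
Qed.

Lemma closed_eq_baire (T : topologicalType) (f g : baire_space -> T) :
  hausdorff_space T -> continuous f -> continuous g ->
  closed [set y | f y = g y].
Proof.
move=> hT cf cg; apply/closed_baire => y yz; apply: contrapT => fg.
have [U [V [oU oV Uf Vg UV]]] := hausdorff_open hT fg.
have [m mU] := (continuous_baire _).1 cf y U oU Uf.
have [n nV] := (continuous_baire _).1 cg y V oV Vg.
have [z yzmn fgz] := yz (maxn m n).
suff : (U `&` V) (f z) by rewrite UV.
split; first by apply/mU/(agree_le _ yzmn)/leq_maxl.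
by rewrite fgz; apply/nV/(agree_le _ yzmn)/leq_maxr.
Qed.

Lemma souslin_image (S T : topologicalType) (f : S -> T) (A : set S) :
  continuous f -> souslin A -> souslin (f @` A).
Proof.
move=> cf [K [g [cK cg ->]]]; exists K, (f \o g); split=> //.
  by move=> y; apply: continuous_comp; [exact: cg|exact: cf].
by rewrite image_comp.
Qed.

Lemma souslin_bigcup (T : topologicalType) (F : nat -> set T) :
  (forall n, souslin (F n)) -> souslin (\bigcup_n F n).
Proof.
move=> sF; have h n : exists Kg : set baire_space * (baire_space -> T),
    [/\ closed Kg.1, continuous Kg.2 & F n = Kg.2 @` Kg.1].
  by have [K [g]] := sF n; exists (K, g).
have [Kg KgP] := choice h; pose sh (y : nat -> nat) i := y i.+1.
exists [set y | (Kg (y 0)).1 (sh y)], (fun y => (Kg (y 0)).2 (sh y)); split.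
- apply/closed_baire => y yz /=; have [cK _ _] := KgP (y 0).
  apply: ((closed_baire _).1 cK) => n; have [z yzn Kz] := yz n.+1.
  by exists (sh z) => [i ni|]; [exact: yzn|rewrite (yzn 0)].
- apply/continuous_baire => y U oU Uy; have [_ cg _] := KgP (y 0).
  have [n nU] := (continuous_baire _).1 cg (sh y) U oU Uy.
  by exists n.+1 => z yz; rewrite -(yz 0) //; apply: nU => i ni; exact: yz.
- apply/seteqP; split=> [x [n _]|x [y Ky <-]]; last first.
    by exists (y 0) => //; have [_ _ ->] := KgP (y 0); exists (sh y).
  have [_ _ ->] := KgP n; move=> [y Ky <-].
  by exists (fun i => if i is j.+1 then y j else n).
Qed.

Lemma souslin_bigcap (T : topologicalType) (F : nat -> set T) :
  hausdorff_space T -> (forall n, souslin (F n)) -> souslin (\bigcap_n F n).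
Proof.
move=> hT sF; have h n : exists Kg : set baire_space * (baire_space -> T),
    [/\ closed Kg.1, continuous Kg.2 & F n = Kg.2 @` Kg.1].
  by have [K [g]] := sF n; exists (K, g).
have [Kg KgP] := choice h.
have cg n : continuous (fun y : baire_space => (Kg n).2 (rowseq n y)).
  by apply: continuous_comp_baire; [exact: rowseq_continuous|have [] := KgP n].
exists (\bigcap_n ((rowseq n : baire_space -> baire_space) @^-1` (Kg n).1 `&`
  [set y : baire_space | (Kg n).2 (rowseq n y) = (Kg 0).2 (rowseq 0 y)])).
exists (fun y => (Kg 0).2 (rowseq 0 y)); split; last first.
- apply/seteqP; split=> [x Fx|x [y yP <-] n _]; last first.
    have [_ _ ->] := KgP n; have [Kn <-] := yP n I.
    by exists (rowseq n y).
  have h' n : exists y, (Kg n).1 y /\ (Kg n).2 y = x.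
    by have := Fx n I; have [_ _ ->] := KgP n; move=> [y]; exists y.
  have [y yP] := choice h'; exists (of_rows y); last by rewrite rowseq_of_rows (yP 0).2.
  by move=> n _; split; rewrite /= !rowseq_of_rows ?(yP n).2 ?(yP 0).2 //; exact: (yP n).1.
- exact: cg.
- apply: closed_bigI => n _; apply: closedI; last exact: closed_eq_baire.
  by apply: closed_preimage; [exact: rowseq_continuous|have [] := KgP n].
Qed.

Lemma souslinI (T : topologicalType) (A B : set T) :
  hausdorff_space T -> souslin A -> souslin B -> souslin (A `&` B).
Proof.
move=> hT sA sB; rewrite (_ : A `&` B = \bigcap_n (if n is 0 then A else B)).
  by apply: souslin_bigcap => // -[].
by apply/seteqP; split=> [x [Ax Bx] [|n] _|x h] //; split; [exact: h 0 I|exact: h 1 I].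
Qed.

Lemma souslin_preimage (T : topologicalType) (f : baire_space -> T) (A : set T) :
  hausdorff_space T -> continuous f -> souslin A -> souslin (f @^-1` A).
Proof.
move=> hT cf [K [g [cK cg ->]]].
exists ((rowseq 1 : baire_space -> baire_space) @^-1` K `&`
  [set y : baire_space | f (rowseq 0 y) = g (rowseq 1 y)]).
exists (rowseq 0); split; last first.
- apply/seteqP; split=> [y [z Kz zy]|_ [y [Ky yz] <-]]; last by exists (rowseq 1 y).
  exists (of_rows (fun n => if n is 0 then y else z)); last by rewrite rowseq_of_rows.
  by split; rewrite /= !rowseq_of_rows.
- exact: rowseq_continuous.
- apply: closedI; first by apply: closed_preimage => //; exact: rowseq_continuous.
  by apply: closed_eq_baire => //; apply: continuous_comp_baire => //; exact: rowseq_continuous.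
Qed.

Lemma closed_souslin_baire (K : set baire_space) : closed K -> souslin K.
Proof. by move=> cK; exists K, id; rewrite image_id; split=> // y; exact: cvg_id. Qed.

Section BaireImage.
Variables (T : topologicalType) (phi : baire_space -> T).
Hypotheses (hT : hausdorff_space T) (phi_cont : continuous phi).
Hypothesis phi_surj : forall x, exists y, phi y = x.

Lemma closed_souslin (K : set T) : closed K -> souslin K.
Proof.
move=> cK; exists (phi @^-1` K), phi; split=> //; first exact: closed_preimage.
apply/seteqP; split=> [x Kx|_ [y Ky <-]] //.
by have [y yx] := phi_surj x; exists y; rewrite /= ?yx.
Qed.

Lemma open_souslin (U : set T) : open U -> souslin U.
Proof.
move=> oU.
pose N (s : seq nat) : set baire_space := [set y | agree (size s) y (nth 0 s)].
pose G m := if unpickle m is Some s then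
  (if pselect (N s `<=` phi @^-1` U) then phi @` N s else set0) else set0.
have -> : U = \bigcup_m G m.
  apply/seteqP; split=> [x Ux|x [m _]]; last first.
    rewrite /G; case: (unpickle m) => // s.
    by case: pselect => //= sU [y /sU Uy <-].
  have [y yx] := phi_surj x; rewrite -yx in Ux *.
  have [n nU] := (continuous_baire _).1 phi_cont y U oU Ux.
  have ns z : N (mkseq y n) z <-> agree n y z.
    rewrite /N /= size_mkseq; split=> h i ni; have := h i ni; rewrite nth_mkseq //.
  exists (pickle (mkseq y n)) => //; rewrite /G pickleK.
  case: pselect => [sU|[]] /=; last by move=> z /ns /nU.
  by exists y => //; apply/ns.
apply: souslin_bigcup => m; rewrite /G; have s0 := closed_souslin (@closed0 T).
case: (unpickle m) => [s|] //; case: pselect => // _ /=.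
exists (N s), phi; split=> //; apply/closed_baire => y yz i si.
by have [z yzs <-] := yz (size s); [exact: yzs|].
Qed.

Lemma borel_souslin (B : set T) : borel B -> souslin B /\ souslin (~` B).
Proof.
move: B; apply: smallest_sub => [|U oU]; last first.
  by split; [exact: open_souslin|apply: closed_souslin; rewrite closedC].
split=> [|B [sB sCB]|F sF].
- by rewrite setC0; split; apply: closed_souslin; [exact: closed0|exact: closedT].
- by rewrite setTD setCK.
- split; first by apply: souslin_bigcup => n; case: (sF n).
  by rewrite setC_bigcup; apply: souslin_bigcap => // n; case: (sF n).
Qed.

End BaireImage.

(** * Independent sets *)

Definition independent (X : Type) (A : set (nat -> X)) (C : set X) : Prop :=
  forall x, A x -> ~ forall i, C (x i).

Lemma borel_bigcup (X : topologicalType) (F : nat -> set X) :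
  (forall n, borel (F n)) -> borel (\bigcup_n F n).
Proof. exact: sigma_algebra_bigcup. Qed.

Lemma borelC (X : topologicalType) (B : set X) : borel B -> borel (~` B).
Proof. by move=> bB; rewrite -setTD; exact: sigma_algebraCD. Qed.

Lemma borel_bigcap (X : topologicalType) (F : nat -> set X) :
  (forall n, borel (F n)) -> borel (\bigcap_n F n).
Proof.
move=> bF; rewrite -(setCK (\bigcap_n F n)) setC_bigcap; apply: borelC.
by apply: borel_bigcup => n; exact: borelC.
Qed.

Lemma open_borel (X : topologicalType) (U : set X) : open U -> borel U.
Proof. exact: sub_sigma_algebra. Qed.

Lemma borel0 (X : topologicalType) : borel (@set0 X).
Proof. by apply: open_borel; exact: open0. Qed.

Lemma borelT (X : topologicalType) : borel (@setT X).
Proof. by apply: open_borel; exact: openT. Qed.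

Lemma infinite_branch (P : seq nat -> Prop) :
  P [::] -> (forall s, P s -> exists k, P (rcons s k)) ->
  exists w, forall n, P (mkseq w n).
Proof.
move=> P0 PS; have h s : exists k, P s -> P (rcons s k).
  by have [/PS[k Pk]|nP] := pselect (P s); [exists k|exists 0 => /nP].
have [k kP] := choice h.
pose t := fix t n := if n is m.+1 then rcons (t m) (k (t m)) else [::].
exists (fun n => k (t n)) => n.
have -> : mkseq (fun n => k (t n)) n = t n.
  by elim: n => //= n IHn; rewrite mkseqS IHn.
by elim: n => //= n; exact: kP.
Qed.

Section Separation.
Variables (X : topologicalType) (A : set (pow_omega X)).
Variable psi : baire_space -> pow_omega X.
Hypotheses (hX : hausdorff_space X) (psi_cont : continuous psi).
Hypothesis psi_range : A = range psi.
Variables (K : set baire_space) (g : baire_space -> X).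
Hypotheses (cK : closed K) (g_cont : continuous g).

(** A finite sequence [s] stands for an initial segment of a sequence [w]; the
    cylinder around [w] is a product of cylinders around its rows. *)
Let cyl (s : seq nat) (c : nat) : set baire_space :=
  [set z | forall i : nat, pickle (c, i) < size s -> z i = nth 0 s (pickle (c, i))].

Let cyl_split s c (i : nat) z :
  pickle (c, i) = size s -> cyl s c z -> cyl (rcons s (z i)) c z.
Proof.
move=> ci sz j; rewrite size_rcons nth_rcons ltnS leq_eqVlt => /orP[/eqP cj|cj].
  have : (c, j) = (c, i) by apply: (pcan_inj pickleK); rewrite ci.
  by move=> [->]; rewrite ci ltnn eqxx.
by rewrite cj; exact: sz.
Qed.

Let cyl_keep s (c : nat) k z :
  ~ (exists i : nat, pickle (c, i) = size s) -> cyl s c z -> cyl (rcons s k) c z.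
Proof.
move=> nc sz j; rewrite size_rcons nth_rcons ltnS leq_eqVlt => /orP[/eqP cj|cj].
  by case: nc; exists j.
by rewrite cj; exact: sz.
Qed.

(* Changing all the digits of [w] from [n] on does not affect the first [m] digits
   of the row, so these are digits of [w] below [n]. *)
Let cyl_row w c m : exists n, forall z, cyl (mkseq w n) c z -> agree m (rowseq c w) z.
Proof.
have [n nP] := rowseq_finitary c m; exists n => z sz.
pose w' : nat -> nat := fun p => if p < n then w p else (w p).+1.
have row_lt i : i < m -> pickle (c, i) < n.
  move=> im; rewrite ltnNge; apply/negP => ni.
  have ww' : agree n w w' by move=> p pn; rewrite /w' pn.
  by have := nP w w' ww' i im; rewrite /rowseq /w' ltnNge ni /= => /n_Sn.
by move=> i /row_lt ni; rewrite sz ?size_mkseq // nth_mkseq.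
Qed.

Let separated (s : seq nat) : Prop := exists B : nat -> set X,
  [/\ forall i, borel (B i),
      forall i z, cyl s i.+1 z -> K z -> B i (g z) &
      forall y, cyl s 0 y -> ~ forall i, B i (psi y i)].

Let separated_split s : (forall k, separated (rcons s k)) -> separated s.
Proof.
move=> /choice[B BP].
pose hit c := exists i, pickle (c : nat, i : nat) = size s.
exists (fun i => if pselect (hit i.+1) then \bigcup_k B k i else \bigcap_k B k i).
split=> [i|i z sz Kz|y sy BB].
- case: pselect => h /=; [apply: borel_bigcup|apply: borel_bigcap] => k;
  by have [] := BP k.
- case: pselect => [[j ij]|nh] /=.
    by exists (z j) => //; have [_ h _] := BP (z j); apply: h => //; exact: cyl_split.
  by move=> k _; have [_ h _] := BP k; apply: h => //; exact: cyl_keep.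
have hit_inj c c' : hit c -> hit c' -> c = c'.
  move=> [i ci] [i' ci']; have : (c, i) = (c', i').
    by apply: (pcan_inj pickleK); rewrite ci.
  by case.
suff [k [sk Bk]] : exists k, cyl (rcons s k) 0 y /\ forall i, B k i (psi y i).
  by have [_ _ h] := BP k; exact: h sk Bk.
have [[j j0]|n0] := pselect (hit 0).
  exists (y j); split=> [|i]; first exact: cyl_split.
  have := BB i; case: pselect => [hi|_] /= BBi; last exact: BBi.
  by have := hit_inj _ _ hi (ex_intro _ j j0).
have [[i hi]|nhit] := pselect (exists i, hit i.+1).
  have := BB i; case: pselect => [_|//] [k _ Bk]; exists k.
  split=> [|i']; first exact: cyl_keep.
  have := BB i'; case: pselect => [hi'|_] /= BBi'; last exact: BBi'.
  by have [->] := hit_inj _ _ hi' hi.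
exists 0; split=> [|i]; first exact: cyl_keep.
have := BB i; case: pselect => [hi|_] /= BBi; last exact: BBi.
by case: nhit; exists i.
Qed.

(** If there were no such set, splitting the cylinders, one row at a time, would
    lead to a branch all of whose initial segments are inseparable. Its first row
    gives an element of [A] and the other rows give points of the independent
    set, so the two disagree at some coordinate; disjoint neighbourhoods there
    separate a sufficiently long initial segment. *)
Lemma independent_separation :
  independent A (g @` K) ->
  exists B, [/\ borel B, g @` K `<=` B & independent A B].
Proof.
move=> indep; have [[B [bB KB AB]]|nsep] := pselect (separated [::]).
  exists (\bigcap_i B i); split; first exact: borel_bigcap.
    by move=> _ [z Kz <-] i _; exact: KB.
  move=> x; rewrite psi_range => -[y _ <-] BB; apply: (AB y) => // i.
  by apply: (BB i).
have [s ns|w wP] := infinite_branch (P := fun s => ~ separated s) nsep.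
  by apply: contrapT => h; apply/ns/separated_split => k; apply: contrapT => ?; apply: h; exists k.
have B_at (i : nat) (V : set X) j :
    (if j == i then V else setT) = [set x | j = i -> V x].
  by apply/seteqP; case: eqP => [->|ji]; split=> x //=; exact.
have Kw i : K (rowseq i.+1 w).
  apply/((closed_baire _).1 cK) => m; apply: contrapT => nK.
  have [n nP] := cyl_row w i.+1 m; apply: (wP n).
  exists (fun j => if j == i then set0 else setT); split=> [j|j z sz Kz|y _].
  - by case: ifP => _; [exact: borel0|exact: borelT].
  - by rewrite B_at => ji; apply: nK; exists z => //; apply: nP; rewrite -ji.
  - by move=> /(_ i); rewrite eqxx.
have /indep nS : A (psi (rowseq 0 w)) by rewrite psi_range; exists (rowseq 0 w).
exfalso; apply: nS => i; exists (rowseq i.+1 w) => //; apply: contrapT => /nesym gw.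
have [U [V [oU oV Ux Vg UV]]] := hausdorff_open hX gw.
have psi_i : continuous (fun y : baire_space => psi y i).
  exact: coord_comp_continuous.
have [m mU] := (continuous_baire _).1 psi_i _ U oU Ux.
have [m' mV] := (continuous_baire _).1 g_cont _ V oV Vg.
have [n nP] := cyl_row w 0 m; have [n' nP'] := cyl_row w i.+1 m'.
have mono c p q z : p <= q -> cyl (mkseq w q) c z -> cyl (mkseq w p) c z.
  move=> pq sz j; rewrite size_mkseq => jp; rewrite sz ?size_mkseq ?(leq_trans jp) //.
  by rewrite !nth_mkseq ?(leq_trans jp).
apply: (wP (maxn n n')).
exists (fun j => if j == i then V else setT); split=> [j|j z sz Kz|y sy BB].
- by case: ifP => _; [exact: open_borel|exact: borelT].
- rewrite B_at => ji; apply: mV; apply: nP'; rewrite -ji.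
  by apply: mono sz; exact: leq_maxr.
- have := BB i; rewrite eqxx => Vy.
  suff : (U `&` V) (psi y i) by rewrite UV.
  by split=> //; apply: mU; apply: nP; apply: mono sy; exact: leq_maxl.
Qed.

End Separation.

(** * Borel colorings *)

Definition colorable (X : topologicalType) (A : set (pow_omega X)) (Z : set X) : Prop :=
  exists C : nat -> set X,
    (forall k, borel (C k) /\ independent A (C k)) /\ Z = \bigcup_k C k.

Section Colorable.
Variables (X : topologicalType) (A : set (pow_omega X)).

Lemma colorable_borel (Z : set X) : colorable A Z -> borel Z.
Proof. by move=> [C [CP ->]]; apply: borel_bigcup => k; case: (CP k). Qed.

Lemma colorable_bigcup (Z : nat -> set X) :
  (forall n, colorable A (Z n)) -> colorable A (\bigcup_n Z n).
Proof.
move=> /choice[C CP].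
exists (fun m => if unpickle m is Some (n, k) then C n k else set0); split.
  move=> m; case: (unpickle m) => [[n k]|]; first exact: (CP n).1.
  by split=> [|x _ /(_ 0)//]; exact: borel0.
apply/seteqP; split=> x.
  by move=> [n _]; rewrite (CP n).2 => -[k _ Cx]; exists (pickle (n, k)); rewrite ?pickleK.
move=> [m _]; case: (unpickle m) => [[n k]|] // Cx.
by exists n => //; rewrite (CP n).2; exists k.
Qed.

Lemma independent_colorable (B : set X) :
  borel B -> independent A B -> colorable A B.
Proof.
move=> bB iB; exists (fun=> B); split=> //.
by apply/seteqP; split=> x; [exists 0|case].
Qed.

Lemma colorableU (Y Z : set X) :
  colorable A Y -> colorable A Z -> colorable A (Y `|` Z).
Proof.
move=> cY cZ; rewrite -bigcup2E; apply: colorable_bigcup => -[|[|n]] //=.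
by apply: independent_colorable; [exact: borel0|move=> x _ /(_ 0)].
Qed.

Lemma colorable_reducible : colorable A setT -> borel_reducible A not_diagonal.
Proof.
move=> [C [CP CT]].
have h x : exists k, C k x /\ forall i, i < k -> ~ C i x.
  have exk : exists k, `[< C k x >].
    by have [k _ Ck] : (\bigcup_k C k) x; [rewrite -CT|exists k; apply/asboolP].
  exists (ex_minn exk); case: ex_minnP => k /asboolP Ck kmin; split=> // i ik /asboolP Ci.
  by have := kmin i Ci; rewrite leqNgt ik.
have [c cP] := choice h.
exists c => [B _|x Ax cx]; last first.
  have {}cx i : c (x i) = c (x 0) := cx i.
  by have [_ /(_ x Ax)] := CP (c (x 0)); apply=> i; rewrite -(cx i); exact: (cP (x i)).1.
pose D k := C k `&` ~` \bigcup_i (if i < k then C i else set0).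
have -> : c @^-1` B = \bigcup_k (if pselect (B k) then D k else set0).
  apply/seteqP; split=> x.
    move=> Bx; exists (c x) => //; case: pselect => //= _.
    split; first exact: (cP x).1.
    by move=> [i _]; case: ifP => // ik; exact: (cP x).2.
  move=> [k _]; case: pselect => //= Bk [Ck nC]; suff -> : c x = k by [].
  apply/eqP; rewrite eqn_leq; apply/andP; split; rewrite leqNgt; apply/negP => lt.
    by apply: (cP x).2 Ck.
  by apply: nC; exists (c x) => //; rewrite lt; exact: (cP x).1.
apply: borel_bigcup => k; case: pselect => // _ /=; last exact: borel0.
rewrite -[D k]setCK setCI setCK; apply: borelC; rewrite -bigcup2E.
apply: borel_bigcup => -[|[|n]] /=; last exact: borel0.
  by apply: borelC; case: (CP k).
by apply: borel_bigcup => i; case: ifP => _; [case: (CP i)|exact: borel0].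
Qed.

End Colorable.

(** * Configurations *)

(** A sequence [w] codes a labelling of the vertices [t] of length [n] and of the
    edges of [A_omega] below level [n]: the first row of [w] labels the edge that
    joins the copies of level [n.-1], and row [j.+1] codes the labelling of the
    [j]-th copy. Only the first [n] digits of [t] are relevant. *)
Fixpoint vertex (n : nat) (w t : nat -> nat) : nat -> nat :=
  if n is m.+1 then vertex m (rowseq (t m).+1 w) t else w.

(** Only the digits of [t] beyond the [k]-th are read, so that [t] selects a copy
    of the edge at level [k] and not a point of it; [k < n] is intended. *)
Fixpoint edge (n k : nat) (w t : nat -> nat) : nat -> nat :=
  if n is m.+1 then
    if k == m then rowseq 0 w else edge m k (rowseq (t m).+1 w) t
  else w.

Lemma vertex_finitary n t : finitary (fun w => vertex n w t).
Proof.
elim: n => [|n IHn]; first exact: finitary_id.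
exact: finitary_comp IHn (@rowseq_finitary _).
Qed.

Lemma edge_finitary n k t : finitary (fun w => edge n k w t).
Proof.
elim: n => [|n IHn] /=; first exact: finitary_id.
case: eqP => _; first exact: rowseq_finitary.
exact: finitary_comp IHn (@rowseq_finitary _).
Qed.

Lemma vertex_ext n w t t' : agree n t t' -> vertex n w t = vertex n w t'.
Proof.
elim: n w => //= n IHn w tt'; rewrite tt' //; apply: IHn.
exact: agree_le tt'.
Qed.

Lemma edge_ext n k w t t' : agree n t t' -> edge n k w t = edge n k w t'.
Proof.
elim: n w => //= n IHn w tt'; rewrite tt' //; case: eqP => // _; apply: IHn.
exact: agree_le tt'.
Qed.

Lemma label_modulus : exists l : nat -> nat, forall n w w', agree (l n) w w' ->
  agree n (vertex n w (stem n)) (vertex n w' (stem n)) /\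
  forall k, k < n -> agree n (edge n k w (stem n)) (edge n k w' (stem n)).
Proof.
suff h n : exists m, forall w w', agree m w w' ->
    agree n (vertex n w (stem n)) (vertex n w' (stem n)) /\
    forall k, k < n -> agree n (edge n k w (stem n)) (edge n k w' (stem n)).
  by have [l lP] := choice h; exists l.
have [m mP] := vertex_finitary n (stem n) n.
have [p pP] := choice (fun k => edge_finitary n k (stem n) n).
exists (maxn m (\max_(k < n) p k)) => w w' ww'; split=> [|k kn].
  by apply/mP/(agree_le _ ww')/leq_maxl.
apply/pP/(agree_le _ ww')/(leq_trans _ (leq_maxr _ _)).
exact: (leq_bigmax (Ordinal kn)).
Qed.

Section Configurations.
Variables (X : topologicalType) (A : set (pow_omega X)).
Variables (phi : baire_space -> X) (psi : baire_space -> pow_omega X).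
Hypotheses (hX : hausdorff_space X).
Hypotheses (phi_cont : continuous phi) (phi_surj : forall x, exists y, phi y = x).
Hypotheses (psi_cont : continuous psi) (psi_range : A = range psi).

Let psi_i i : continuous (fun y : baire_space => psi y i).
Proof. exact: coord_comp_continuous. Qed.

(** A configuration is a labelling in which the label of every edge is a
    parameter of an edge of [A] between the points labelled along it; the set
    [Z] is to be avoided. The entries of [l], highest level first, prescribe
    finite beginnings of the codes at each level. Each entry bears on all the
    copies of its level at once: this is how finitely many digits, hence
    countably many prescriptions, control infinitely many vertices. *)
Fixpoint good (Z : set X) (l : seq (seq nat)) (w : nat -> nat) : Prop :=
  if l is s :: l' then
    [/\ agree (size s) w (nth 0 s),
        forall j, good Z l' (rowseq j.+1 w) &
        forall j, psi (rowseq 0 w) j =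
          phi (vertex (size l') (rowseq j.+1 w) (stem (size l')))]
  else ~ Z (phi w).

Lemma good_antitone (Y Z : set X) l w : Y `<=` Z -> good Z l w -> good Y l w.
Proof.
move=> YZ; elim: l w => [|s l IHl] w /=; first by move=> nZ /YZ.
by move=> [sw gl wE]; split=> // j; exact: IHl.
Qed.

Lemma good_avoids Z l w t : good Z l w -> ~ Z (phi (vertex (size l) w t)).
Proof. by elim: l w => //= s l IHl w [_ gl _]; exact: IHl. Qed.

Lemma good_souslin Z l : borel Z -> souslin (good Z l : set baire_space).
Proof.
move=> bZ; elim: l => [|s l IHl].
  apply: (souslin_preimage (A := ~` Z) hX phi_cont).
  by have [] := borel_souslin hX phi_cont phi_surj bZ.
have hB : hausdorff_space baire_space.
  by apply: hausdorff_product => _; exact: discrete_hausdorff.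
have row_comp j (T : topologicalType) (f : baire_space -> T) : continuous f ->
    continuous (fun w : baire_space => f (rowseq j w)).
  by move=> cf; apply: continuous_comp_baire => //; exact: rowseq_continuous.
rewrite (_ : (good Z (s :: l) : set baire_space) =
  [set w : baire_space | agree (size s) w (nth 0 s)] `&`
  ((\bigcap_j ((rowseq j.+1 : baire_space -> baire_space) @^-1` good Z l)) `&`
   [set w : baire_space | forall j, psi (rowseq 0 w) j =
      phi (vertex (size l) (rowseq j.+1 w) (stem (size l)))])); last first.
  apply/seteqP; split=> w /=.
    by move=> [sw gl wE]; do 2?split=> //; move=> j _; exact: gl.
  by move=> [sw [gl wE]]; split=> // j; exact: (gl j I).
apply: souslinI => //; last apply: souslinI => //.
- apply/closed_souslin_baire/closed_baire => y yz i si.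
  by have [z yzs <-] := yz (size s); [exact: yzs|].
- apply: souslin_bigcap => // j; apply: souslin_preimage => //.
  exact: rowseq_continuous.
- apply: closed_souslin_baire.
  rewrite (_ : mkset _ = \bigcap_j [set w : baire_space | psi (rowseq 0 w) j =
      phi (vertex (size l) (rowseq j.+1 w) (stem (size l)))]); last first.
    by apply/seteqP; split=> w h j; [move=> _; exact: h|exact: (h j I)].
  apply: closed_bigI => j _; apply: closed_eq_baire => //.
    exact: (row_comp 0 X (fun y => psi y j) (@psi_i j)).
  apply: (row_comp j.+1 _ (fun w => phi (vertex (size l) w (stem (size l))))).
  apply: continuous_comp_baire => //.
  by apply: finitary_continuous; exact: vertex_finitary.
Qed.

(** There are countably many prescriptions, so a single colorable set meets all
    the configurations of every prescription that some colorable set kills. *)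
Lemma universal_null_set : exists2 Z, colorable A Z &
  forall l Y, colorable A Y -> (forall w, ~ good Y l w) -> forall w, ~ good Z l w.
Proof.
have h l : exists Y, colorable A Y /\ ((exists Y', colorable A Y' /\
    forall w, ~ good Y' l w) -> forall w, ~ good Y l w).
  have [[Y [cY nY]]|no] := pselect (exists Y', colorable A Y' /\
    forall w, ~ good Y' l w); first by exists Y.
  exists set0; split=> [|/no//].
  by apply: independent_colorable; [exact: borel0|move=> x _ /(_ 0)].
have [Y YP] := choice h.
exists (\bigcup_m if unpickle m is Some l then Y l else set0).
  by apply: colorable_bigcup => m; exact: (YP _).1.
move=> l Y' cY' nY' w gw; apply: ((YP l).2 _ w); first by exists Y'.
apply: good_antitone gw => x Yx; exists (pickle l) => //; by rewrite pickleK.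
Qed.

(** The values at [stem (size l)] of the configurations avoiding [Z] form a
    Souslin set. Were it independent, a Borel independent set containing it could
    be added to [Z], and no configuration would remain. So [A] has an edge all of
    whose points are such values, and it joins configurations of level [size l]
    into one of the next level. *)
Lemma good_extend Z l w :
  colorable A Z ->
  (forall Y, colorable A Y -> (forall w, ~ good Y l w) -> forall w, ~ good Z l w) ->
  good Z l w ->
  forall m, exists w', good Z (mkseq w' m :: l) w'.
Proof.
move=> cZ Zuniv gw m.
pose val w := phi (vertex (size l) w (stem (size l))).
have val_cont : continuous (val : baire_space -> X).
  apply: continuous_comp_baire => //.
  by apply: finitary_continuous; exact: vertex_finitary.
have [K [g [cK cg gK]]] :=
  souslin_image val_cont (good_souslin l (colorable_borel cZ)).
have [indep|dep] := pselect (independent A (g @` K)).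
  have [B [bB KB iB]] := independent_separation hX psi_cont psi_range cK cg indep.
  exfalso; apply: (Zuniv (B `|` Z) _ _ w gw).
    by apply: colorableU => //; exact: independent_colorable.
  move=> v gv; apply: (good_avoids (t := stem (size l)) gv); left.
  apply: KB; rewrite -gK; exists v => //.
  by apply: good_antitone gv => x Zx; right.
move/existsNP: dep => [x /not_implyP[Ax /contrapT xK]].
have h j : exists v, good Z l v /\ val v = x j.
  by have := xK j; rewrite -gK => -[v gv vx]; exists v.
have [v vP] := choice h; move: Ax; rewrite psi_range => -[z _ zx].
pose w' := of_rows (fun j => if j is i.+1 then v i else z); exists w'.
split=> [i|j|j]; rewrite ?size_mkseq /w' ?rowseq_of_rows.
- by move=> im; rewrite nth_mkseq.
- exact: (vP j).1.
- by rewrite zx -(vP j).2.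
Qed.

(** This transports the prescriptions of level [k] to all later levels: the
    labels around [t] in a later configuration are labels of a configuration of
    level [k]. *)
Lemma good_descend Z (L : nat -> seq (seq nat)) (t : nat -> nat) n k w :
  (forall i, size (L i) = i) -> (forall i, exists s, L i.+1 = s :: L i) ->
  k <= n -> good Z (L n) w ->
  exists w', [/\ good Z (L k) w', vertex n w t = vertex k w' t &
    forall m, m < k -> edge n m w t = edge k m w' t].
Proof.
move=> sL LS; elim: n w => [|n IHn] w.
  by rewrite leqn0 => /eqP-> gw; exists w.
rewrite leq_eqVlt => /predU1P[->|]; first by exists w.
rewrite ltnS => kn; have [s ->] := LS n; move=> [_ gl _].
have [w' [gw' vE eE]] := IHn _ kn (gl (t n)); exists w'; split=> // m mk.
by rewrite /= ltn_eqF ?eE // (leq_trans mk).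
Qed.

(** The point of index 0 stands for the whole edge, since [edge] ignores the
    digits up to [k]. *)
Lemma good_edge Z l w k i g : good Z l w -> k < size l ->
  psi (edge (size l) k w (edge_point k 0 g)) i =
  phi (vertex (size l) w (edge_point k i g)).
Proof.
elim: l w => //= s l IHl w [_ gl wE]; rewrite ltnS leq_eqVlt => /predU1P[->|kl].
  rewrite eqxx edge_point_diag wE; congr phi; apply: vertex_ext.
  by apply: agree_sym; exact: edge_point_stem.
by rewrite ltn_eqF // IHl // !(@edge_point_tail k _ 0).
Qed.

End Configurations.

(** The [i]-th digit of the limit can be read at any hit beyond [i], because two
    hits are compared at a common later stage. *)
Lemma limit_of_hits (f : nat -> nat -> nat) (hit : set nat) :
  (forall m, exists2 k, m <= k & hit k) ->
  (forall k n, hit k -> k <= n -> agree k (f n) (f k)) ->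
  exists h, forall k n, hit k -> k <= n -> agree k (f n) h.
Proof.
move=> hit_inf fhit; have h i : exists k, i < k /\ hit k.
  by have [k ik hk] := hit_inf i.+1; exists k.
have [K KP] := choice h; exists (fun i => f (K i) i) => k n hk kn i ik.
have [iK hK] := KP i; rewrite (fhit _ _ hk kn) //.
rewrite -(fhit k (maxn k (K i))) ?leq_maxl //.
by rewrite (fhit (K i)) ?leq_maxr.
Qed.

(** * The dichotomy *)

(** Along a generic sequence the labels of the vertices and of the edges converge.
    The relation between them passes to the limit, the space being Hausdorff, and
    one stem suffices to decide a neighbourhood of the value, whence the
    measurability. *)
Lemma uncolorable_reducible (X : topologicalType) (A : set (pow_omega X))
    (phi : baire_space -> X) (psi : baire_space -> pow_omega X) :
  hausdorff_space X -> continuous phi -> (forall x, exists y, phi y = x) ->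
  continuous psi -> A = range psi ->
  ~ colorable A setT -> baire_reducible A_omega A.
Proof.
move=> hX phi_cont phi_surj psi_cont psi_range nT.
have [Z cZ Zuniv] := universal_null_set A phi psi.
have [l lP] := label_modulus.
have [w0 w0Z] : exists w0, ~ Z (phi w0).
  apply: contrapT => no; apply: nT; rewrite -(_ : Z = setT) //.
  apply/seteqP; split=> x // _; have [y <-] := phi_surj x.
  by apply: contrapT => nZ; apply: no; exists y.
have step (p : seq (seq nat) * (nat -> nat)) : exists w', good phi psi Z p.1 p.2 ->
    good phi psi Z (mkseq w' (l (size p.1).+1) :: p.1) w'.
  have [gp|ng] := pselect (good phi psi Z p.1 p.2); last by exists w0 => /ng.
  have [w' gw'] := good_extend hX phi_cont phi_surj psi_cont psi_range cZ
    (Zuniv p.1) gp (l (size p.1).+1).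
  by exists w'.
have [next nextP] := choice step.
pose st := fix st n : seq (seq nat) * (nat -> nat) := if n is m.+1
  then (mkseq (next (st m)) (l (size (st m).1).+1) :: (st m).1, next (st m))
  else ([::], w0).
pose L n := (st n).1; pose W n := (st n).2.
have good_st n : good phi psi Z (L n) (W n).
  by elim: n => [|n IHn] //; exact: nextP IHn.
have sL n : size (L n) = n by elim: n => // n IHn; rewrite /L /=; congr _.+1.
have LS n : L n.+1 = mkseq (W n.+1) (l n.+1) :: L n by rewrite /L /W /= -/(L n) sL.
(* The copy of level [k] around [t] begins like [W k], and [l k] is large enough
   for this beginning to decide [k] digits of each label at [stem k]. *)
have frozen t k n : agree k t (stem k) -> k <= n ->
    agree k (vertex n (W n) t) (vertex k (W k) t) /\
    forall m, m < k -> agree k (edge n m (W n) t) (edge k m (W k) t).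
  move=> tk kn.
  have [w' [gw' vE eE]] := good_descend t sL (fun i => ex_intro _ _ (LS i)) kn (good_st n).
  have ww' : agree (l k) w' (W k) \/ k = 0.
    case: (k) gw' => [|k'] gw'; first by right.
    left; move: gw'; rewrite LS => -[h _ _] i il.
    by rewrite h ?size_mkseq // nth_mkseq.
  case: ww' => [ww'|->]; last by split.
  have [hv he] := lP k _ _ ww'; split=> [|m mk].
    by rewrite vE !(vertex_ext _ tk).
  by rewrite eE // !(edge_ext _ _ tk); exact: he.
have hits t : generic t -> forall m, exists2 k, m <= k & agree k t (stem k).
  by move=> gt m; exact: generic_stem.
have vlim t : exists h, generic t ->
    forall k n, agree k t (stem k) -> k <= n -> agree k (vertex n (W n) t) h.
  have [gt|ng] := pselect (generic t); last by exists id => /ng.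
  have [h hP] := limit_of_hits (f := fun n => vertex n (W n) t)
    (hit := [set k | agree k t (stem k)]) (hits t gt)
    (fun k n tk kn => (frozen t k n tk kn).1).
  by exists h.
have [v vP] := choice vlim.
apply: (baire_reducible_generic (u0 := fun t => phi (v t))) => [m g gg|V oV].
  have g0 := gg 0; set t := edge_point m 0 g in g0.
  have hits_above p : exists2 k, p <= k & m < k /\ agree k t (stem k).
    have [k] := hits t g0 (maxn p m.+1); rewrite geq_max => /andP[pk mk] tk.
    by exists k.
  have [e eP] := limit_of_hits (f := fun n => edge n m (W n) t)
    (hit := [set k | m < k /\ agree k t (stem k)]) hits_above
    (fun k n tk kn => (frozen t k n tk.2 kn).2 m tk.1).
  rewrite psi_range; exists e => //; apply/funext => i; apply: contrapT => ne.
  have [U [V [oU oV Ue Vv UV]]] := hausdorff_open hX ne.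
  have [p pU] := (continuous_baire _).1 (coord_comp_continuous (i := i) psi_cont) _ U oU Ue.
  have [q qV] := (continuous_baire _).1 phi_cont _ V oV Vv.
  have [k pk [mk tk]] := hits_above p.
  have [k' qk' tk'] := hits _ (gg i) q.
  pose n := maxn k k'; have kn : k <= n by exact: leq_maxl.
  have k'n : k' <= n by exact: leq_maxr.
  have mn : m < size (L n) by rewrite sL (leq_trans mk).
  have := good_edge i g (good_st n) mn; rewrite sL => eE.
  suff : (U `&` V) (psi (edge n m (W n) t) i) by rewrite UV.
  split; first by apply: pU; apply: agree_sym; apply: agree_le pk _; exact: (eP k n).
  rewrite eE; apply: qV; apply: agree_sym; apply: agree_le qk' _.
  exact: (vP _ (gg i) k' n).
exists [set y | exists k, agree k y (stem k) /\
    forall z, agree k (vertex k (W k) y) z -> V (phi z)].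
  apply/open_baire => y [k [yk kV]]; exists k => x yx; exists k.
  split; first by apply: agree_trans yk; exact: agree_sym.
  by rewrite -(vertex_ext _ yx).
move=> y gy; split=> [Vy|[k [yk kV]]]; last by apply: kV; exact: (vP y gy k k).
have [p pV] := (continuous_baire _).1 phi_cont _ V oV Vy.
have [k pk yk] := hits y gy p; exists k; split=> // z yz; apply: pV.
apply: agree_le pk _; apply: agree_trans yz; apply: agree_sym.
exact: (vP y gy k k).
Qed.

Theorem theorem1p7 (R : realType) (X : topologicalType)
    (A : set (pow_omega X)) (polishX : polish R X) (analyticA : analytic R A) :
  (borel_reducible A not_diagonal \/ baire_reducible A_omega A) /\
  ~ (borel_reducible A not_diagonal /\ baire_reducible A_omega A).
Proof.
split; last by move=> [red_a red_b]; exact: reductions_exclusive red_a red_b.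
have [red_a|nred] := pselect (borel_reducible A not_diagonal); [by left|right].
have [Y [f [polishY f_cont fA]]] := analyticA.
have [[y0 _]|noY] := pselect (exists y : Y, True); last first.
  exfalso; apply: nred; exists (fun=> 0) => [B _|x]; last first.
    by rewrite fA => -[y _ _]; case: noY; exists y.
  have [B0|nB0] := pselect (B 0).
    by rewrite (_ : _ @^-1` _ = setT) ?preimage_cst ?mem_set //; exact: borelT.
  rewrite (_ : _ @^-1` _ = set0); first exact: borel0.
  by apply/seteqP; split=> x.
have [phi phi_cont phi_surj] := polish_baire_image (f y0 0) polishX.
have [h h_cont h_surj] := polish_baire_image y0 polishY.
apply: (@uncolorable_reducible X A phi (f \o h)) => //.
- exact: polish_hausdorff polishX.
- by move=> y; apply: continuous_comp; [exact: h_cont|exact: f_cont].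
- rewrite fA; apply/seteqP; split=> _ [y _ <-]; last by exists (h y).
  by have [z <-] := h_surj y; exists z.
- by move=> cT; apply: nred; exact: colorable_reducible.
Qed.
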